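(* Let $Q\in\mathcal{N}_{\kappa}(\mathcal{H})$ be holomorphic at $\infty$ with $Q'(\infty):=\lim_{z\to\infty}zQ(z)$ boundedly invertible, and let $Q(z)=\Gamma^{+}(A-z)^{-1}\Gamma$ be its minimal representation with a bounded self-adjoint operator $A$ in a Pontryagin space $\mathcal{K}$ and a bounded operator $\Gamma:\mathcal{H}\to\mathcal{K}$; put $P:=\Gamma(\Gamma^{+}\Gamma)^{-1}\Gamma^{+}$. Let $\hat A$ be the representing linear relation of $\hat Q(z):=-Q(z)^{-1}$ in the representation $$\hat Q(z)=\hat Q(\bar z_0)+(z-\bar z_0)\hat\Gamma^{+}\left(I+(z-z_0)(\hat A-z)^{-1}\right)\hat\Gamma,\qquad \hat\Gamma:=-\Gamma_{z_0}Q(z_0)^{-1}.$$ Then $$\hat A(0)=R(P)=R(\Gamma),$$ and $\hat A(0)$ is not degenerate (i.e. $[\cdot,\cdot]$ is nondegenerate on $\hat A(0)$).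
   Context: $(\mathcal{H},(\cdot,\cdot))$ is a Hilbert space and $\mathcal{L}(\mathcal{H})$ the space of bounded operators on it. For an integer $\kappa\ge 0$, $\mathcal{N}_\kappa(\mathcal{H})$ is the class of functions $Q:\mathcal{D}(Q)\to\mathcal{L}(\mathcal{H})$ that are meromorphic in $\mathbb{C}\setminus\mathbb{R}$, satisfy $Q(z)^*=Q(\bar z)$, and whose kernel $\mathcal{N}_Q(z,w)=\frac{Q(z)-Q(w)^*}{z-\bar w}$, $z,w\in\mathcal{D}(Q)\cap\mathbb{C}^+$, has $\kappa$ negative squares (every Hermitian matrix $((\mathcal{N}_Q(z_i,z_j)h_i,h_j))_{i,j=1}^n$ has at most $\kappa$ negative eigenvalues, and for at least one choice of $n,z_i,h_i$ exactly $\kappa$). $\mathcal{D}(Q)$ is the domain of holomorphy of $Q$. ''$Q$ is holomorphic at $\infty$'' means that $Q$ is holomorphic in a neighbourhood of $\infty$ and the limit $Q'(\infty):=\lim_{z\to\infty}zQ(z)$ exists in the operator norm (so $Q(\infty)=0$). Such $Q$ has a representation $Q(z)=\Gamma^{+}(A-z)^{-1}\Gamma$, $z\in\mathcal{D}(Q)=\rho(A)$, as in the claim, which is minimal, i.e. $\mathcal{K}$ is the closed linear span of $\{(A-z)^{-1}\Gamma h: z\in\rho(A),h\in\mathcal{H}\}$; $Q'(\infty)=-\Gamma^{+}\Gamma$. Adjoints: $(\Gamma^{+}k,h)=[k,\Gamma h]$. Put $\Gamma_z:=(A-z)^{-1}\Gamma$ for $z\in\rho(A)$, and let $z_0$ be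 a non-real point of $\mathcal{D}(Q)$ at which $Q(z_0)$ is boundedly invertible. A linear relation in $\mathcal{K}$ is a linear subspace $T\subseteq\mathcal{K}\times\mathcal{K}$; $T(0):=\{g:\{0,g\}\in T\}$; $R(\cdot)$ denotes range. The representing relation $\hat A$ is the self-adjoint linear relation in $\mathcal{K}$ determined by the known formula $$(\hat A-z)^{-1}=(A-z)^{-1}-\Gamma_zQ(z)^{-1}\Gamma_{\bar z}^{+},\qquad z\in\rho(A)\cap\rho(\hat A).$$ *)

(* Defs.v *)
(* MathComp / MathComp-Analysis; complex numbers are R[i] with R : realType. *)
From HB Require Import structures.
From mathcomp Require Import all_boot all_order all_algebra.
From mathcomp Require Import all_classical all_reals all_analysis.
From mathcomp.real_closed Require Import complex.
Set Implicit Arguments.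
Unset Strict Implicit.
Unset Printing Implicit Defensive.
Import Order.TTheory GRing.Theory Num.Theory.
Import numFieldNormedType.Exports.
Local Open Scope classical_set_scope.
Local Open Scope complex_scope.
Local Open Scope ring_scope.

Section LinearSets.
Variables (C : pzRingType) (V : lmodType C).

Definition linear_subspace (S : set V) : Prop :=
  S 0 /\ forall (a : C) (x y : V), S x -> S y -> S (a *: x + y).

Definition linear_span (S : set V) : set V :=
  [set x | exists (n : nat) (a : 'I_n -> C) (v : 'I_n -> V),
     (forall i, S (v i)) /\ x = \sum_(i < n) a i *: v i].

End LinearSets.

Section Operators.
Variable R : realType.
Local Notation C := R[i].

Definition bounded_operator (V W : normedModType C) (f : V -> W) : Prop :=
  linear f /\ exists M : C, forall x, `|f x| <= M * `|x|.

Definition boundedly_invertible (V W : normedModType C) (f : V -> W) : Prop :=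
  exists2 g : W -> V, bounded_operator g & cancel f g /\ cancel g f.

(* The inverse of a bijective operator; meaningless on a vector which does not
   have exactly one preimage. *)
Definition op_inv (V W : normedModType C) (f : V -> W) (y : W) : V :=
  xget 0 [set x | f x = y].

(* The adjoint T^+ : W -> V of T : V -> W with respect to the forms fV on V and
   fW on W, characterized by fV (T^+ w) v = fW w (T v). *)
Definition adjoint (V W : normedModType C) (fV : V -> V -> C)
    (fW : W -> W -> C) (T : V -> W) (w : W) : V :=
  xget 0 [set u | forall v, fV u v = fW w (T v)].

(* The inner product is linear in its first argument and induces the norm, for
   which the space is complete. *)
Definition hilbert_space (H : completeNormedModType C)
    (ip : {dot H for Num.conj}) : Prop :=
  forall x, ip x x = `|x| ^+ 2.

(* A fundamental decomposition K = Kp [+] Km, with Km of finite dimension. The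
   norm of K is equivalent to the norm ([x+,x+] - [x-,x-])^(1/2) which the
   decomposition defines; hence the form is positive definite on Kp and negative
   definite on Km, and, K being complete, Kp is a Hilbert space. *)
Definition pontryagin_space (K : completeNormedModType C)
    (f : {hermitian K for false & Num.conj}) : Prop :=
  exists Kp Km : set K,
    [/\ linear_subspace Kp,
        exists (n : nat) (e : 'I_n -> K), Km = linear_span (range e),
        forall x, exists xp xm, [/\ Kp xp, Km xm & x = xp + xm],
        forall xp xm, Kp xp -> Km xm -> f xp xm = 0
      & exists c d : C, [/\ 0 < c, 0 < d & forall xp xm, Kp xp -> Km xm ->
          c * `|xp + xm| ^+ 2 <= f xp xp - f xm xm <= d * `|xp + xm| ^+ 2]].

End Operators.

Section LinearRelations.
Variables (R : realType) (K : normedModType R[i]).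
Local Notation C := R[i].
Implicit Types (T : set (K * K)) (z : C).

Definition graph (f : K -> K) : set (K * K) := [set p | p.2 = f p.1].

Definition rel_inv T : set (K * K) := [set p | T (p.2, p.1)].

(* T - z = { {x, y - z x} : {x, y} \in T } *)
Definition rel_sub T z : set (K * K) := [set p | T (p.1, p.2 + z *: p.1)].

Definition mul_part T : set K := [set g | T (0, g)].

Definition resolvent_set T : set C :=
  [set z | exists2 S : K -> K,
     bounded_operator S & rel_inv (rel_sub T z) = graph S].

(* The operator with graph (T - z)^-1, for z in the resolvent set of T. *)
Definition resolvent T z (x : K) : K :=
  xget 0 [set y | rel_inv (rel_sub T z) (x, y)].

Definition rel_adjoint (f : K -> K -> C) T : set (K * K) :=
  [set p | forall q, T q -> f q.2 p.1 = f q.1 p.2].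

Definition self_adjoint_relation (f : K -> K -> C) T : Prop :=
  linear_subspace T /\ rel_adjoint f T = T.

Definition nondegenerate_on (f : K -> K -> C) (S : set K) : Prop :=
  forall x, S x -> (forall y, S y -> f x y = 0) -> x = 0.

End LinearRelations.

Section OperatorFunctions.
Variables (R : realType) (H : completeNormedModType R[i]).
Local Notation C := R[i].
Implicit Types (D : set C) (Q : C -> H -> H).

(* Convergence in the operator norm: || T z - L || <= e eventually. *)
Definition op_cvg (F : set_system C) (T : C -> H -> H) (L : H -> H) : Prop :=
  forall e : C, 0 < e -> F [set z | forall h, `|T z h - L h| <= e * `|h|].

Definition holomorphic_on D Q : Prop :=
  [/\ open (D : set C^o),
      forall z, D z -> bounded_operator (Q z)
    & forall a, D a -> exists2 L : H -> H, bounded_operator L &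
        op_cvg (dnbhs (a : C^o)) (fun z h => (z - a)^-1 *: (Q z h - Q a h)) L].

Definition domain_of_holomorphy D Q : Prop :=
  holomorphic_on D Q /\
  forall D' Q', D `<=` D' -> holomorphic_on D' Q' ->
    (forall z, D z -> Q' z =1 Q z) -> D' `<=` D.

Definition meromorphic_off_real D Q : Prop :=
  forall a : C, complex.Im a != 0 ->
    exists (U : set C) (n : nat) (G : C -> H -> H),
      [/\ U a, holomorphic_on U G
        & forall z, U z -> z != a ->
            D z /\ forall h, Q z h = (z - a) ^- n *: G z h].

Definition nbhs_infty : set_system C :=
  [set S | exists r : R, forall z : C, r%:C < `|z| -> S z].

(* Q is holomorphic at infinity with Q'(oo) = lim z Q(z) = Qinf. *)
Definition holomorphic_at_infty D Q (Qinf : H -> H) : Prop :=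
  [/\ nbhs_infty D, bounded_operator Qinf
    & op_cvg nbhs_infty (fun z h => z *: Q z h) Qinf].

(* Algebraic multiplicities are counted. *)
Definition nb_neg_eigenvalues n (M : 'M[C]_n) : nat :=
  count (fun x : C => x < 0)
    (sval (closed_field_poly_normal (char_poly M))).

Variable ip : {dot H for Num.conj}.

Definition nevanlinna_kernel Q (z w : C) (h : H) : H :=
  (z - w^*)^-1 *: (Q z h - adjoint ip ip (Q w) h).

Definition nevanlinna_matrix Q n (z : 'I_n -> C) (h : 'I_n -> H) : 'M[C]_n :=
  \matrix_(i, j) ip (nevanlinna_kernel Q (z i) (z j) (h i)) (h j).

(* The class N_kappa(H); the function is Q, with domain of holomorphy D. *)
Definition generalized_nevanlinna (kappa : nat) D Q : Prop :=
  let admissible n (z : 'I_n -> C) :=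
    forall i, D (z i) /\ 0 < complex.Im (z i) in
  [/\ domain_of_holomorphy D Q,
      meromorphic_off_real D Q,
      forall z, D z -> D z^* /\ adjoint ip ip (Q z) =1 Q z^*,
      forall n (z : 'I_n -> C) (h : 'I_n -> H), admissible n z ->
        (nb_neg_eigenvalues (nevanlinna_matrix Q z h) <= kappa)%N
    & exists (n : nat) (z : 'I_n -> C) (h : 'I_n -> H), admissible n z /\
        nb_neg_eigenvalues (nevanlinna_matrix Q z h) = kappa].

Variables (K : completeNormedModType C)
  (f : {hermitian K for false & Num.conj}).
Implicit Types (A : K -> K) (G : H -> K) (Ahat : set (K * K)).

(* Gamma_z = (A - z)^-1 Gamma *)
Definition gamma_at A G (z : C) (h : H) : K := resolvent (graph A) z (G h).

(* Q(z) = G^+ (A - z)^-1 G on D(Q) = rho(A), with A bounded and self-adjoint,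
   minimal. *)
Definition minimal_representation D Q A G : Prop :=
  [/\ bounded_operator A /\ (forall x y, f (A x) y = f x (A y)),
      bounded_operator G,
      D = resolvent_set (graph A),
      forall z, D z -> Q z =1 adjoint ip f G \o gamma_at A G z
    & closure (linear_span [set x | exists z h,
        resolvent_set (graph A) z /\ x = gamma_at A G z h]) = [set: K]].

(* P = G (G^+ G)^-1 G^+ *)
Definition proj_gamma G (k : K) : K :=
  G (op_inv (adjoint ip f G \o G) (adjoint ip f G k)).

Definition neg_inv Q (z : C) (h : H) : H := - op_inv (Q z) h.

Definition gamma_hat Q A G (z0 : C) (h : H) : K :=
  - gamma_at A G z0 (op_inv (Q z0) h).

(* Ahat is the representing relation of -Q^-1 with base point z0, where A and G
   represent Q. On rho(A) \cap rho(Ahat) the operators Q(z) are invertible, so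
   there -Q^-1 is given by neg_inv. *)
Definition representing_relation Q A G (z0 : C) Ahat : Prop :=
  let rho := resolvent_set (graph A) `&` resolvent_set Ahat in
  let Gh := gamma_hat Q A G z0 in
  [/\ self_adjoint_relation f Ahat,
      resolvent_set Ahat z0,
      forall z, rho z -> rel_inv (rel_sub Ahat z) =
        graph (fun x => resolvent (graph A) z x -
          gamma_at A G z (op_inv (Q z) (adjoint ip f (gamma_at A G z^*) x)))
    & forall z, rho z -> forall h,
        neg_inv Q z h = neg_inv Q z0^* h +
          (z - z0^*) *: adjoint ip f Gh
                          (Gh h + (z - z0) *: resolvent Ahat z (Gh h))].

End OperatorFunctions.

(* Main.v *)
Require Import Defs.
From HB Require Import structures.
From mathcomp Require Import all_boot all_order all_algebra.
From mathcomp Require Import all_classical all_reals all_analysis.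
From mathcomp.real_closed Require Import complex.
From mathcomp Require Import ring.
Set Implicit Arguments.
Unset Strict Implicit.
Import Order.TTheory GRing.Theory Num.Theory.
Import numFieldNormedType.Exports.
Local Open Scope classical_set_scope.
Local Open Scope complex_scope.
Local Open Scope ring_scope.

(* Evaluating the resolvent formula at z0 ∈ ρ(A) ∩ ρ(Ahat) gives
   Ahat(0) = ker (Ahat - z0)^-1: the vectors g such that
     (A - z0)^-1 g = Γ_z0 Q(z0)^-1 Γ_(conj z0)^+ g.
   Applying A - z0 shows that such a g lies in R(Γ), and the converse holds
   because Γ_(conj z0)^+ Γ = Γ^+ Γ_z0 = Q(z0). Letting z tend to infinity in
   z Q(z) gives Γ^+ Γ = - Q'(∞), which is injective: hence P fixes R(Γ), and
   the form is nondegenerate there. *)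

(** * Bounds for Hermitian forms *)

Section Forms.
Variables (R : realType) (K : normedModType R[i]).
Variable f : {hermitian K for false & Num.conj}.

Lemma herm_conj (x y : K) : f y x = (f x y)^*.
Proof. by rewrite hermC expr0 mul1r. Qed.

Lemma hermZr (a : R[i]) (x y : K) : f x (a *: y) = a^* * f x y.
Proof. by rewrite herm_conj linearZl_LR rmorphM/= -herm_conj. Qed.

Lemma herm_polarization (x y : K) :
  4 * f x y = f (x + y) (x + y) - f (x - y) (x - y)
    + 'i * (f (x + 'i *: y) (x + 'i *: y) - f (x - 'i *: y) (x - 'i *: y)).
Proof.
have fDB (u v : K) :
    f (u + v) (u + v) - f (u - v) (u - v) = 2 * (f u v + f v u).
  by rewrite !(linearDl, linearDr, linearNl, linearNr) /=; ring.
rewrite !fDB linearZl_LR hermZr conjCi /=.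
transitivity (2 * (f x y + f y x) + 2 * ('i ^+ 2 * f y x - 'i ^+ 2 * f x y)).
  by rewrite sqrCi; ring.
by ring.
Qed.

(** Polarization turns a bound on the diagonal into continuity of [f x y] in [x]: for a unit vector
    [x] all four terms obey one bound depending only on [d] and [y], and homogeneity does the rest.
    It serves both the indefinite form of [K] and the inner product of [H]. *)
Lemma quadratic_bound_form_bounded (d : R[i]) (y : K) :
    (forall u, `|f u u| <= d * `|u| ^+ 2) ->
  exists2 M : R[i], 0 <= M & forall x, `|f x y| <= M * `|x|.
Proof.
move=> fd.
have quad (u v : K) : `|u| = 1 -> `|v| = `|y| ->
    `|f (u + v) (u + v)| <= `|d| * (1 + `|y|) ^+ 2.
  move=> u1 vy; apply: le_trans (fd _) _.
  (* No sign of [d] is given, but this product dominates a norm, so [d] can be replaced by its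
     absolute value. *)
  have dr : 0 <= d * `|u + v| ^+ 2 by apply: le_trans (fd (u + v)).
  rewrite -(ger0_norm dr) normrM ler_wpM2l//.
  by rewrite normrX normr_id -u1 -vy lerXn2r ?nnegrE ?addr_ge0 ?ler_normD.
exists (`|d| * (1 + `|y|) ^+ 2) => [|x].
  by rewrite mulr_ge0 ?exprn_ge0 ?addr_ge0.
have [->|x0] := eqVneq x 0; first by rewrite linear0l !normr0 mulr0.
have nx0 : `|x| != 0 by rewrite normr_eq0.
set u := `|x|^-1 *: x.
have u1 : `|u| = 1 by rewrite normrZ normfV normr_id mulVf.
have -> : x = `|x| *: u by rewrite scalerA divff ?scale1r.
rewrite linearZl_LR /= normrM normr_id [`|_ *: u|]normrZ normr_id u1 mulr1 mulrC.
(* The factor 4 of the polarization identity matches its four terms, each bounded by [quad]. *)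
rewrite ler_wpM2r// -(@ler_pM2l _ 4)//.
have -> : 4 * `|f u y| = `|4 * f u y| by rewrite normrM ger0_norm.
rewrite herm_polarization.
apply: le_trans (ler_normD _ _) _; rewrite normrM normCi mul1r.
apply: le_trans (lerD (ler_normB _ _) (ler_normB _ _)) _.
have ny : `|- y| = `|y| by rewrite normrN.
have niy : `|'i *: y| = `|y| by rewrite normrZ normCi mul1r.
have nniy : `|- ('i *: y)| = `|y| by rewrite normrN.
apply: le_trans (lerD (lerD (quad _ _ u1 erefl) (quad _ _ u1 ny))
  (lerD (quad _ _ u1 niy) (quad _ _ u1 nniy))) _.
by rewrite le_eqVlt; apply/orP; left; apply/eqP; ring.
Qed.

End Forms.

(** The form is nonnegative on [Kp] and nonpositive on [Km], as the norm equivalence shows with one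
    component zero. Hence the absolute value of [f u u] is at most [f xp xp - f xm xm], which the
    same equivalence bounds. *)
Lemma pontryagin_quadratic_bound (R : realType) (K : completeNormedModType R[i])
    (f : {hermitian K for false & Num.conj}) :
  pontryagin_space f -> exists d : R[i], forall u, `|f u u| <= d * `|u| ^+ 2.
Proof.
move=> [Kp [Km [[Kp0 _] [n [e KmE]] dec orth [c [d [c0 d0 cd]]]]]].
have Km0 : Km 0.
  rewrite KmE; exists 0%N, (fun=> 0), (fun=> 0); split => [[]//|].
  by rewrite big_ord0.
exists d => u; have [xp [xm [Kxp Kxm ->]]] := dec u.
have -> : f (xp + xm) (xp + xm) = f xp xp + f xm xm.
  by apply: hnormDd; exact: orth.
have fp0 : 0 <= f xp xp.
  have /andP[+ _] := cd xp 0 Kxp Km0; rewrite linear0l subr0 addr0.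
  by apply: le_trans; rewrite mulr_ge0 ?exprn_ge0// ltW.
have fm0 : f xm xm <= 0.
  have /andP[+ _] := cd 0 xm Kp0 Kxm; rewrite linear0l sub0r add0r -oppr_ge0.
  by apply: le_trans; rewrite mulr_ge0 ?exprn_ge0// ltW.
apply: le_trans (ler_normD _ _) _.
rewrite ger0_norm// ler0_norm//.
by have /andP[] := cd _ _ Kxp Kxm.
Qed.

(** * Adjoints and inverses defined by choice *)

Section Adjoint.
Variables (R : realType) (V W : normedModType R[i]).
Variables (ip : {dot V for Num.conj}) (fW : W -> W -> R[i]) (T : V -> W).

Lemma dot_inj (u u' : V) : (forall v, ip u v = ip u' v) -> u = u'.
Proof.
move=> uu'; apply/eqP; rewrite -subr_eq0; apply: contraT => nz.
have : 0 < ip (u - u') (u - u') by exact: neq0_dnorm_gt0.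
have -> : ip (u - u') (u - u') = ip u (u - u') - ip u' (u - u').
  exact: linearBl.
by rewrite uu' subrr ltxx.
Qed.

Lemma adjoint_eq (w : W) (u : V) :
  (forall v, ip u v = fW w (T v)) -> adjoint ip fW T w = u.
Proof.
move=> uw; apply: xget_unique => // u' u'w.
by apply: dot_inj => v; rewrite u'w uw.
Qed.

(* The adjoint is defined by choice, with junk value 0, so a nonzero value
   certifies that the adjoint exists there, without a Riesz theorem. *)
Lemma adjoint_neq0P (w : W) : adjoint ip fW T w != 0 ->
  forall v, ip (adjoint ip fW T w) v = fW w (T v).
Proof.
by rewrite /adjoint; case: xgetP => [u -> //|_]; rewrite eqxx.
Qed.

End Adjoint.

Lemma linear_map0 (C : pzRingType) (V W : lmodType C) (g : V -> W) :
  linear g -> g 0 = 0.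
Proof.
by move=> lg; have := lg (-1) 0 0; rewrite addr0 scaleN1r oppr0 scaleN1r addNr.
Qed.

Lemma op_inv_can (R : realType) (V W : normedModType R[i]) (g : V -> W)
    (v : V) : injective g -> op_inv g (g v) = v.
Proof. by move=> gI; apply: xget_unique => // u /gI. Qed.

(** * Resolvents of linear relations *)

Section Resolvent.
Variables (R : realType) (K : normedModType R[i]).

Lemma resolventP (T : set (K * K)) (z : R[i]) (x y : K) :
  resolvent_set T z -> (resolvent T z x = y <-> T (y, x + z *: y)).
Proof.
move=> [S _ TS].
have TP y' : rel_inv (rel_sub T z) (x, y') <-> y' = S x by rewrite TS.
have -> : resolvent T z x = S x.
  by apply: xget_unique => [|y' /TP//]; apply/TP.
by split=> [<-|Ty]; [apply/TP | symmetry; apply/TP].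
Qed.

Lemma resolvent_graphP (A : K -> K) (z : R[i]) (x : K) :
  resolvent_set (graph A) z ->
  A (resolvent (graph A) z x) = x + z *: resolvent (graph A) z x.
Proof. by move=> Az; apply/esym/(resolventP _ _ Az). Qed.

End Resolvent.

(** * Estimates near infinity *)

Section NbhsInfty.
Variable R : realType.
Implicit Types S T : set R[i].

Lemma nbhs_inftyI S T : nbhs_infty S -> nbhs_infty T -> nbhs_infty (S `&` T).
Proof.
move=> [r Sr] [t Tt]; exists (Num.max r t) => z zrt.
split; [apply: Sr|apply: Tt]; apply: le_lt_trans zrt;
  by rewrite lecR le_max lexx ?orbT.
Qed.

Lemma nbhs_infty_ex S : nbhs_infty S -> exists z, S z.
Proof.
move=> [r Sr]; exists (`|r| + 1)%:C; apply: Sr.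
rewrite ger0_norm ?lecR ?addr_ge0//.
by rewrite ltcR (le_lt_trans (ler_norm r))// ltrDl.
Qed.

Lemma nbhs_infty_norm_gt (c : R[i]) : 0 <= c -> nbhs_infty [set z | c < `|z|].
Proof.
move=> c0; exists (complex.Re c) => z /=.
by rewrite RRe_real// ger0_real.
Qed.

End NbhsInfty.

(** With y the resolvent applied to x, z y = A y - x gives (|z| - |M|) |y| <= |x|, and |z| > |M| +
    1/e then suffices. *)
Lemma resolvent_decay (R : realType) (K : normedModType R[i]) (A : K -> K)
    (e : R[i]) : bounded_operator A -> 0 < e ->
  nbhs_infty [set z | resolvent_set (graph A) z ->
    forall x, `|resolvent (graph A) z x| <= e * `|x|].
Proof.
move=> [_ [M AM]] e0.
have [] := nbhs_infty_norm_gt (c := `|M| + e^-1).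
  by rewrite addr_ge0// invr_ge0 ltW.
move=> r rz; exists r => z /rz /= zM Az x.
have := resolvent_graphP x Az; set y := resolvent _ _ _ => Ay.
have AyM : `|A y| <= `|M| * `|y|.
  have Ay0 : 0 <= M * `|y| by apply: le_trans (AM y).
  by rewrite (le_trans (AM y))// -{1}(ger0_norm Ay0) normrM normr_id.
have zy : `|z| * `|y| <= `|M| * `|y| + `|x|.
  rewrite -normrZ (_ : z *: y = A y - x); last by rewrite Ay addrC addKr.
  by rewrite (le_trans (ler_normB _ _))// lerD2r.
rewrite -ler_pdivrMl//.
rewrite -(lerD2l (`|M| * `|y|)) -mulrDl (le_trans _ zy)//.
by rewrite ler_wpM2r// ltW.
Qed.

(** If [T z h] vanished, [L h] would be too small for the bounded inverse of [L]: |h| <= |M| / (|M|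
    + 1) |h|. Applied to z Q(z), this supplies the nonzero values that [dot_representation] asks
    for. *)
Lemma op_cvg_infty_neq0 (R : realType) (H : completeNormedModType R[i])
    (T : R[i] -> H -> H) (L : H -> H) :
  op_cvg (@nbhs_infty R) T L -> boundedly_invertible L ->
  nbhs_infty [set z | forall h, h != 0 -> T z h != 0].
Proof.
move=> TL [S [_ [M SM]] [SK _]].
have e0 : 0 < (`|M| + 1)^-1 by rewrite invr_gt0 ltr_wpDl.
have [r Tr] := TL _ e0; exists r => z /Tr /= Tz h; apply: contraNneq => Tzh.
have := Tz h; rewrite Tzh sub0r normrN => Lh.
have : `|h| <= `|M| * ((`|M| + 1)^-1 * `|h|).
  rewrite -{1}(SK h); apply: le_trans (SM _) _.
  have SM0 : 0 <= M * `|L h| by apply: le_trans (SM _).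
  by rewrite -(ger0_norm SM0) normrM normr_id ler_wpM2l.
rewrite mulrCA ler_pdivlMl ?ltr_wpDl// mulrDl mul1r gerDl => h0.
by rewrite -normr_eq0 eq_le h0 normr_ge0.
Qed.

(** * Consequences of the representation of Q *)

Section Representation.
Variables (R : realType) (H K : completeNormedModType R[i]).
Variables (ip : {dot H for Num.conj}) (f : {hermitian K for false & Num.conj}).
Variables (D : set R[i]) (Q : R[i] -> H -> H) (A : K -> K) (G : H -> K).
Hypothesis Asym : forall x y, f (A x) y = f x (A y).
Hypothesis DE : D = resolvent_set (graph A).
Hypothesis QE : forall z, D z -> Q z =1 adjoint ip f G \o gamma_at A G z.

Lemma dot_representation z h v : D z -> Q z h != 0 ->
  ip (Q z h) v = f (gamma_at A G z h) (G v).
Proof. by move=> Dz; rewrite QE//= => /adjoint_neq0P. Qed.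

Lemma gamma_atP z h : D z -> A (gamma_at A G z h) = G h + z *: gamma_at A G z h.
Proof. by rewrite DE => Az; exact: resolvent_graphP. Qed.

(** Since A Γ_z = Γ + z Γ_z and A is symmetric, [Γh, Γv] = [Γ_z h, AΓv] - (z Q(z)h, v). As z tends
    to infinity, the first term vanishes by [resolvent_decay] and the second tends to -(Q'(∞)h,
    v). *)
Lemma gram_residue (Qinf : H -> H) :
  hilbert_space ip -> pontryagin_space f ->
  holomorphic_at_infty D Q Qinf -> boundedly_invertible Qinf ->
  bounded_operator A -> bounded_operator G ->
  forall h v, f (G h) (G v) = - ip (Qinf h) v.
Proof.
move=> ipH /pontryagin_quadratic_bound[d fd] [Dinf [lQinf _] Qcvg] Qinv Ab [lG _] h v.
have [M1 M10 fM1] := quadratic_bound_form_bounded (A (G v)) fd.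
have ipq u : `|ip u u| <= 1 * `|u| ^+ 2 by rewrite ipH normrX normr_id mul1r.
have [M2 M20 ipM2] := quadratic_bound_form_bounded v ipq.
apply/eqP; rewrite -subr_eq0 opprK; set c : R[i] := _ + _.
(* At h = 0 the value of [Q z h] may be the default of [adjoint], so this case is settled by
   linearity. *)
have [h00|h0] := eqVneq h 0.
  by rewrite /c h00 (linear_map0 lG) (linear_map0 lQinf) !linear0l addr0.
apply: contraT => c0.
pose N := M1 * `|G h| + M2 * `|h|.
have N0 : 0 <= N by rewrite addr_ge0// mulr_ge0.
(* The two error terms will add up to at most [N] times this number, which is less than |c|. *)
have e0 : 0 < `|c| / (N + 1) by rewrite divr_gt0 ?normr_gt0// ltr_wpDl.
have := nbhs_inftyI (nbhs_inftyI Dinf (resolvent_decay Ab e0))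
  (nbhs_inftyI (Qcvg _ e0) (op_cvg_infty_neq0 Qcvg Qinv)).
move=> /nbhs_infty_ex[z [[Dz resz] [Qz Qz0]]].
have zQ0 : Q z h != 0 by have := Qz0 h h0; rewrite scaler_eq0 negb_or => /andP[].
have cE : c = f (gamma_at A G z h) (A (G v)) - ip (z *: Q z h - Qinf h) v.
  rewrite -Asym gamma_atP// linearDl linearBl !linearZl_LR /=.
  by rewrite dot_representation// /c; ring.
have : `|c| <= N * (`|c| / (N + 1)).
  rewrite {1}cE (le_trans (ler_normB _ _))// /N mulrDl; apply: lerD.
    rewrite -mulrA (le_trans (fM1 _))// ler_wpM2l// mulrC.
    by apply: resz; rewrite -DE.
  by rewrite -mulrA (le_trans (ipM2 _))// ler_wpM2l// mulrC; exact: Qz.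
by rewrite mulrCA ler_pMr ?normr_gt0// ler_pdivlMr ?ltr_wpDl// mul1r gerDl ler10.
Qed.

Lemma mul_part_representing z0 (Ahat : set (K * K)) :
  bounded_operator G -> (forall z, D z -> D z^*) -> D z0 ->
  boundedly_invertible (Q z0) -> representing_relation ip f Q A G z0 Ahat ->
  mul_part Ahat = range G.
Proof.
move=> [lG _] Dstar Dz0 [Qi [lQi _] [QK KQ]] [_ hz0 hatE _].
have Az0 : resolvent_set (graph A) z0 by rewrite -DE.
have Q0inj : injective (Q z0) := can_inj QK.
have lQ0 : Q z0 0 = 0 by rewrite -{1}(linear_map0 lQi) KQ.
have gamma_adj h : adjoint ip f (gamma_at A G z0^*) (G h) = Q z0 h.
  apply: adjoint_eq => v; have [->|h0] := eqVneq h 0.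
    by rewrite lQ0 (linear_map0 lG) !linear0l.
  rewrite dot_representation//; last by rewrite -lQ0 (inj_eq Q0inj).
  (* Expanding [A Γ_z0 h, Γ_(conj z0) v] on either side produces the same z0 term, because the form
     is conjugate-linear in its second argument. Cancelling it leaves [Γh, Γ_(conj z0) v] =
     [Γ_z0 h, Γv]. *)
  have fl : f (A (gamma_at A G z0 h)) (gamma_at A G z0^* v) =
      f (G h) (gamma_at A G z0^* v)
      + z0 * f (gamma_at A G z0 h) (gamma_at A G z0^* v).
    by rewrite gamma_atP// linearDl linearZl_LR.
  have fr : f (gamma_at A G z0 h) (A (gamma_at A G z0^* v)) =
      f (gamma_at A G z0 h) (G v)
      + z0 * f (gamma_at A G z0 h) (gamma_at A G z0^* v).
    rewrite gamma_atP; last exact: Dstar.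
    rewrite linearDr -[X in X * _]conjCK; congr (_ + _); exact: hermZr.
  by apply: (addIr (z0 * f (gamma_at A G z0 h) (gamma_at A G z0^* v)));
    rewrite -fl -fr Asym.
have key g : mul_part Ahat g <-> resolvent (graph A) z0 g =
    gamma_at A G z0 (op_inv (Q z0) (adjoint ip f (gamma_at A G z0^*) g)).
  (* The pair (g, 0) lies in (Ahat - z0)^-1 exactly when (0, g) lies in [Ahat], since z0 multiplies
     the zero component. *)
  have := hatE z0 (conj Az0 hz0) => /(congr1 (@^~ (g, 0))).
  rewrite /rel_inv/rel_sub/graph/= scaler0 addr0 => E.
  rewrite /mul_part/= E; split=> [/esym/eqP|->]; last by rewrite subrr.
  by rewrite subr_eq0 => /eqP.
apply/seteqP; split=> [g /key E|_ [h _ <-]]; last first.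
  by apply/key; rewrite gamma_adj op_inv_can.
(* The preimage is read off from [E]: applying A - z0 to both sides turns the left into g and the
   right into [G] of this vector. *)
exists (op_inv (Q z0) (adjoint ip f (gamma_at A G z0^*) g)) => //.
by have := resolvent_graphP g Az0; rewrite E gamma_atP// => /addIr.
Qed.

End Representation.

Unset Implicit Arguments.

Theorem proposition3p6 (R : realType)
    (H : completeNormedModType R[i]) (ip : {dot H for Num.conj})
    (K : completeNormedModType R[i])
    (f : {hermitian K for false & Num.conj})
    (kappa : nat) (D : set R[i]) (Q : R[i] -> H -> H) (Qinf : H -> H)
    (A : K -> K) (G : H -> K) (z0 : R[i]) (Ahat : set (K * K)) :
  hilbert_space ip ->
  pontryagin_space f ->
  generalized_nevanlinna ip kappa D Q ->
  holomorphic_at_infty D Q Qinf ->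
  boundedly_invertible Qinf ->
  minimal_representation ip f D Q A G ->
  complex.Im z0 != 0 ->
  D z0 ->
  boundedly_invertible (Q z0) ->
  representing_relation ip f Q A G z0 Ahat ->
  [/\ mul_part Ahat = range (proj_gamma ip f G),
      range (proj_gamma ip f G) = range G
    & nondegenerate_on f (mul_part Ahat)].
Proof.
move=> ipH pK [_ _ Dstar _ _] Qinfty Qinv [[Ab Asym] Gb DE QE _] _ Dz0 Q0inv Arep.
have Grep : forall h v, f (G h) (G v) = - ip (Qinf h) v.
  exact: (gram_residue Asym DE QE ipH pK Qinfty Qinv Ab Gb).
have Qinf_inj : injective Qinf by case: Qinv => Qi _ [/can_inj].
have [lQinf _] : bounded_operator Qinf by case: Qinfty.
have gramE h : adjoint ip f G (G h) = - Qinf h.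
  by apply: adjoint_eq => v; rewrite Grep linearNl.
have PG h : proj_gamma ip f G (G h) = G h.
  rewrite /proj_gamma; congr (G _).
  (* The inverse is taken at a vector already in the image of Γ^+ Γ, so injectivity is enough. *)
  apply: (@op_inv_can _ _ _ (adjoint ip f G \o G)) => h1 h2.
  by rewrite /= !gramE => /oppr_inj/Qinf_inj.
have rPG : range (proj_gamma ip f G) = range G.
  apply/seteqP; split=> [_ [k _ <-]|_ [h _ <-]]; first by eexists.
  by exists (G h).
have mulE : mul_part Ahat = range G.
  apply: (mul_part_representing Asym DE QE Gb _ Dz0 Q0inv Arep) => z Dz.
  by have [] := Dstar z Dz.
split; rewrite ?rPG// mulE => _ [h _ <-] hG.
(* Orthogonality of Γh to all Γv says that Q'(∞)h is orthogonal to all of [H], where the inner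
   product is definite. *)
have /Qinf_inj-> : Qinf h = Qinf 0.
  rewrite (linear_map0 lQinf); apply: (dot_inj (ip := ip)) => v.
  by rewrite linear0l; apply: oppr_inj; rewrite -Grep oppr0 hG//; exists v.
by case: Gb => lG _; rewrite (linear_map0 lG).
Qed.
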